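(* Let $A$ be a positive information algebra, let $L$ be a join-semilattice disjoint from $A$, and let $S=A\uplus_{\mathrm{ord}}L$ be the overflow semiring. For a semiring $R$ let $I^+(R)=\{x\in R: x+x=x\}$ and $I^\times(R)=\{x\in R: x\cdot x=x\}$. Then \[ I^+(S)=I^+(A)\cup L\qquad\text{and}\qquad I^\times(S)=I^\times(A)\cup L. \]
   Context: All semirings are commutative: $(S,+,0)$ and $(S,\cdot,1)$ are commutative monoids, $1\neq 0$, multiplication distributes over addition, and $0$ is absorbing. A semiring is zerosumfree if $a+b=0$ implies $a=b=0$, and entire if $ab=0$ implies $a=0$ or $b=0$; an information algebra is a zerosumfree entire semiring. A positive information algebra is an information algebra with a partial order $\leq$ compatible with $+$ and $\cdot$ (i.e. $x\leq y$ implies $x+z\leq y+z$ and $xz\leq yz$) and having $0$ as least element. Overflow semiring $S=A\uplus_{\mathrm{ord}}L$: for a positive information algebra $A$ and a join-semilattice $L$ disjoint from $A$, $S=A\cup L$ with the order extending those of $A$ and $L$ by $a\leq\ell$ for all $a\in A,\ell\in L$ (and never $\ell\leq a$), and operations: $x+y=x+_Ay$ if $x,y\in A$, $x+y=\sup\{x,y\}$ otherwise; $xy=x\cdot_Ay$ if $x,y\in A\setminus\{0\}$, $xy=0$ if $x=0$ or $y=0$, and $xy=\sup\{x,y\}$ otherwise. With these, $S$ is a positive information algebra. *)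

(* Defs.v *)
From HB Require Import structures.
From mathcomp Require Import all_boot all_order all_algebra.
From mathcomp Require Import classical_sets.

Set Implicit Arguments.
Unset Strict Implicit.
Unset Printing Implicit Defensive.

Import Order.TTheory GRing.Theory.
Local Open Scope ring_scope.

HB.mixin Record isInformationAlgebra R of GRing.ComNzSemiRing R := {
  zerosumfree : forall a b : R, a + b = 0 -> a = 0 /\ b = 0;
  entire : forall a b : R, a * b = 0 -> a = 0 \/ b = 0
}.

#[short(type="infAlgType")]
HB.structure Definition InformationAlgebra :=
  { R of GRing.ComNzSemiRing R & isInformationAlgebra R }.

(* The order is a field of the structure rather than a MathComp porderType:
   the library already fixes the join of additive and order structures to
   ordered groups, which blocks ordered semirings. *)
HB.mixin Record isPositiveInfAlgebra R of InformationAlgebra R := {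
  pia_le : rel R;
  pia_le_refl : reflexive pia_le;
  pia_le_anti : antisymmetric pia_le;
  pia_le_trans : transitive pia_le;
  pia_leD : forall x y z : R, pia_le x y -> pia_le (x + z) (y + z);
  pia_leM : forall x y z : R, pia_le x y -> pia_le (x * z) (y * z);
  pia_ge0 : forall x : R, pia_le 0 x
}.

#[short(type="posInfAlgType")]
HB.structure Definition PositiveInfAlgebra :=
  { R of InformationAlgebra R & isPositiveInfAlgebra R }.

Definition is_sup (T : Type) (le : rel T) (x y s : T) : Prop :=
  [/\ le x s, le y s & forall z : T, le x z -> le y z -> le s z].

(* The disjoint union is a sum type, so that A and L are disjoint by
   construction and sit in it through the injections inA and inL. *)
Definition overflow (d : Order.disp_t) (A : posInfAlgType)
  (L : joinSemilatticeType d) : Type := (A + L)%type.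

Definition inA (d : Order.disp_t) (A : posInfAlgType)
  (L : joinSemilatticeType d) (a : A) : overflow A L := inl a.
Definition inL (d : Order.disp_t) (A : posInfAlgType)
  (L : joinSemilatticeType d) (l : L) : overflow A L := inr l.

Arguments inA {d} A L a.
Arguments inL {d} A L l.

Section Overflow.
Variables (d : Order.disp_t) (A : posInfAlgType).
Variable L : joinSemilatticeType d.
Local Notation S := (overflow A L).
Local Notation inA := (@inA d A L).
Local Notation inL := (@inL d A L).

HB.instance Definition _ := Choice.copy S (A + L)%type.

Definition ov_le (x y : S) : bool :=
  match x, y with
  | inl a, inl b => pia_le a b
  | inl _, inr _ => true
  | inr _, inl _ => false
  | inr l, inr m => (l <= m)%O
  end.

Fact ov_le_refl : reflexive ov_le.
Proof. by case=> x /=; [exact: pia_le_refl | exact: lexx]. Qed.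

Fact ov_le_anti : antisymmetric ov_le.
Proof.
by case=> [a|l] [b|m] //= => [/pia_le_anti|/le_anti] ->.
Qed.

Fact ov_le_trans : transitive ov_le.
Proof.
by case=> [a|l] [b|m] [c|n] //=; [exact: pia_le_trans | exact: le_trans].
Qed.

(* Supremum of x and y when at least one of them is in L (lemma ov_supP).
   Two elements of A need not have one; the value x given to such a pair
   is never used below. *)
Definition ov_sup (x y : S) : S :=
  match x, y with
  | inl _, inl _ => x
  | inl _, inr l => inL l
  | inr l, inl _ => inL l
  | inr l, inr m => inL (Order.join l m)
  end.

Definition ov_zero : S := inA 0.
Definition ov_one : S := inA 1.

Definition ov_add (x y : S) : S :=
  match x, y with
  | inl a, inl b => inA (a + b)
  | _, _ => ov_sup x y
  end.

Definition ov_mul (x y : S) : S :=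
  if (x == ov_zero) || (y == ov_zero) then ov_zero else
  match x, y with
  | inl a, inl b => inA (a * b)
  | _, _ => ov_sup x y
  end.

Lemma ov_supP (x y : S) :
  ~ (exists a b : A, x = inA a /\ y = inA b) ->
  is_sup ov_le x y (ov_sup x y).
Proof.
case: x y => [a|l] [b|m] nAA; first by case: nAA; exists a, b.
- by split=> //=; exact: lexx.
- by split=> //=; exact: lexx.
- split; [exact: leUl | exact: leUr |].
  by case=> [c|n] //= lm mn; rewrite leUx; apply/andP.
Qed.

Fact ov_addA : associative ov_add.
Proof. by case=> [a|l] [b|m] [c|n] //=; rewrite /inA /inL ?addrA ?joinA. Qed.

Fact ov_addC : commutative ov_add.
Proof. by case=> [a|l] [b|m] //=; rewrite 1?addrC 1?joinC. Qed.

Fact ov_add0 : left_id ov_zero ov_add.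
Proof. by case=> [a|l] //=; rewrite add0r. Qed.

HB.instance Definition _ := GRing.isNmodule.Build S ov_addA ov_addC ov_add0.

Fact inA_eq0 (a : A) : ((inl a : S) == ov_zero) = (a == 0).
Proof. by []. Qed.

Fact inL_eq0 (l : L) : ((inr l : S) == ov_zero) = false.
Proof. by []. Qed.

Fact A_mul_eq0 (a b : A) : (a * b == 0) = (a == 0) || (b == 0).
Proof.
apply/eqP/orP => [/entire[]->|[]/eqP->]; rewrite ?mul0r ?mulr0 ?eqxx //.
  by left.
by right.
Qed.

Fact A_add_eq0 (a b : A) : (a + b == 0) = (a == 0) && (b == 0).
Proof.
apply/eqP/andP => [/zerosumfree[-> ->]|[/eqP-> /eqP->]]; first by rewrite eqxx.
by rewrite addr0.
Qed.

Fact ov_mulAA (a b : A) : ov_mul (inA a) (inA b) = inA (a * b).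
Proof.
rewrite /ov_mul !inA_eq0; case: (eqVneq a 0) => [->|_] /=.
  by rewrite mul0r.
by case: (eqVneq b 0) => [->|_] //=; rewrite mulr0.
Qed.

Fact ov_mulAL (a : A) (l : L) :
  ov_mul (inA a) (inL l) = if a == 0 then ov_zero else inL l.
Proof. by rewrite /ov_mul inA_eq0 inL_eq0 orbF; case: eqP. Qed.

Fact ov_mulLA (a : A) (l : L) :
  ov_mul (inL l) (inA a) = if a == 0 then ov_zero else inL l.
Proof. by rewrite /ov_mul inA_eq0 inL_eq0; case: eqP. Qed.

Fact ov_mulLL (l m : L) : ov_mul (inL l) (inL m) = inL (Order.join l m).
Proof. by rewrite /ov_mul !inL_eq0. Qed.

Let ov_mulE := (ov_mulAA, ov_mulAL, ov_mulLA, ov_mulLL).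

Fact ov_mulC : commutative ov_mul.
Proof.
case=> [a|l] [b|m]; rewrite ov_mulE ov_mulE //.
  by rewrite mulrC.
by rewrite joinC.
Qed.

Fact ov_mul0 : left_zero ov_zero ov_mul.
Proof. by case=> [a|l]; rewrite /ov_mul eqxx. Qed.

Fact ov_mulr0 : right_zero ov_zero ov_mul.
Proof. by move=> x; rewrite ov_mulC ov_mul0. Qed.

Fact ov_mulA : associative ov_mul.
Proof.
case=> [a|l] [b|m] [c|n]; rewrite !ov_mulE.
- by rewrite mulrA.
- rewrite A_mul_eq0; case: (eqVneq b 0) => [_|nb]; first by rewrite orbT ov_mulr0.
  by rewrite orbF ov_mulAL.
- case: (eqVneq a 0) => na; case: (eqVneq c 0) => nc;
    by rewrite ?ov_mul0 ?ov_mulr0 ?ov_mulE ?na ?nc ?eqxx ?(negPf na) ?(negPf nc).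
- by case: (eqVneq a 0) => _; rewrite ?ov_mul0 ?ov_mulE.
- rewrite A_mul_eq0; case: (eqVneq b 0) => [_|nb]; first by rewrite ov_mul0.
  by rewrite ov_mulE.
- by case: (eqVneq b 0) => _; rewrite ?ov_mul0 ?ov_mulr0 ?ov_mulE.
- by case: (eqVneq c 0) => _; rewrite ?ov_mul0 ?ov_mulr0 ?ov_mulE.
- by rewrite joinA.
Qed.

Fact ov_mul1 : left_id ov_one ov_mul.
Proof.
by case=> [a|l]; rewrite ov_mulE ?mul1r ?oner_eq0.
Qed.

Fact ov_mulDl : left_distributive ov_mul ov_add.
Proof.
move=> x y; case=> [c|n].
  have [->|nc] := eqVneq c 0; first by rewrite -/ov_zero !ov_mulr0 ov_add0.
  case: x y => [a|l] [b|m]; rewrite /= !ov_mulE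
    ?(negPf nc) //=.
  by rewrite mulrDl.
case: x y => [a|l] [b|m]; rewrite /= !ov_mulE //=.
- rewrite A_add_eq0; case: (eqVneq a 0) => _; case: (eqVneq b 0) => _ //=.
  + by rewrite addr0.
  + by rewrite joinxx.
- by case: (eqVneq a 0) => _ //=; rewrite joinCA joinxx joinC.
- by case: (eqVneq b 0) => _ //=; rewrite -joinA joinxx.
- by rewrite joinACA joinxx.
Qed.

Fact ov_one_neq0 : ov_one != ov_zero.
Proof. by rewrite inA_eq0 oner_neq0. Qed.

HB.instance Definition _ := GRing.Nmodule_isComNzSemiRing.Build S
  ov_mulA ov_mulC ov_mul1 ov_mulDl ov_mul0 ov_one_neq0.

Fact ov_zerosumfree (x y : S) : x + y = 0 -> x = 0 /\ y = 0.
Proof. by case: x y => [a|l] [b|m] // [] /zerosumfree[-> ->]. Qed.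

Fact ov_entire (x y : S) : x * y = 0 -> x = 0 \/ y = 0.
Proof.
have [->|nx] := eqVneq x 0; first by left.
have [->|ny] := eqVneq y 0; first by right.
rewrite /GRing.mul /= /ov_mul (negPf nx) (negPf ny) /=.
case: x y nx ny => [a|l] [b|m] // _ _ [] /entire[]->; first by left.
by right.
Qed.

HB.instance Definition _ := isInformationAlgebra.Build S
  ov_zerosumfree ov_entire.

Fact ov_leD (x y z : S) : ov_le x y -> ov_le (x + z) (y + z).
Proof.
rewrite /GRing.add /=.
case: x y z => [a|l] [b|m] [c|n] //=; rewrite ?lexx ?leUr //.
  exact: pia_leD.
by move=> lm; apply: leU2.
Qed.

Fact ov_ge0 (x : S) : ov_le 0 x.
Proof. by case: x => [a|l] //=; exact: pia_ge0. Qed.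

Fact ov_leM (x y z : S) : ov_le x y -> ov_le (x * z) (y * z).
Proof.
have [->|nx] := eqVneq x 0; first by rewrite mul0r !ov_ge0.
have [->|nz] := eqVneq z 0; first by rewrite !mulr0 ov_le_refl.
have [->|ny] := eqVneq y 0.
  move=> x0; case/negP: nx; apply/eqP/ov_le_anti.
  by rewrite x0 ov_ge0.
rewrite /GRing.mul /= /ov_mul (negPf nx) (negPf ny) (negPf nz) /=.
move: nx ny nz.
case: x y z => [a|l] [b|m] [c|n] //= _ _ _; rewrite ?lexx ?leUr //.
  exact: pia_leM.
by move=> lm; apply: leU2.
Qed.

HB.instance Definition _ := isPositiveInfAlgebra.Build S
  ov_le_refl ov_le_anti ov_le_trans ov_leD ov_leM ov_ge0.

End Overflow.

Local Open Scope classical_set_scope.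

Definition Iadd (R : comNzSemiRingType) : set R := [set x | x + x = x].
Definition Imul (R : comNzSemiRingType) : set R := [set x | x * x = x].
Arguments Iadd R : clear implicits.
Arguments Imul R : clear implicits.

(* Main.v *)
Require Import Defs.
From mathcomp Require Import all_boot all_order all_algebra.
From mathcomp Require Import classical_sets.

Local Open Scope classical_set_scope.

(** Both summands are closed under both operations: on [A] these restrict to the operations of [A],
    and on [L] each is the join, which is idempotent. So [x + x] and [x * x] never leave the summand
    of [x], and [overflow_setE] splits each equality into these two cases. *)

Lemma overflow_setE (d : Order.disp_t) (A : posInfAlgType)
    (L : joinSemilatticeType d) (P : set (overflow A L)) (Q : set A) :
  (forall a, P (inA A L a) <-> Q a) -> (forall l, P (inL A L l)) ->
  P = (inA A L @` Q) `|` range (inL A L).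
Proof.
move=> PA PL; apply/seteqP; split=> [[a|l] Px | _ [[a Qa <-]|[l _ <-]]].
- by left; exists a => //; apply/PA.
- by right; exists l.
- exact/PA.
- exact: PL.
Qed.

Theorem proposition3p1 (d : Order.disp_t) (A : posInfAlgType)
    (L : joinSemilatticeType d) :
  Iadd (overflow A L) = (inA A L @` Iadd A) `|` range (inL A L) /\
  Imul (overflow A L) = (inA A L @` Imul A) `|` range (inL A L).
Proof.
split; apply: overflow_setE => [a|l].
- by split=> [[]|aa] //; congr inl.
- by congr inr; exact: Order.JoinTheory.joinxx.
(* Unlike [ov_add], [ov_mul] tests for zero first and is stuck on a variable [a]; [ov_mulAA]
   resolves the test, as zero is absorbing in [A]. *)
- change (ov_mul (inA A L a) (inA A L a) = inA A L a <-> (a * a)%R = a).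
  by rewrite ov_mulAA; split=> [[]|->].
(* The zero of [S] lies in [A], so here the test fails and the join remains. *)
- change (ov_mul (inL A L l) (inL A L l) = inL A L l).
  by rewrite ov_mulLL Order.JoinTheory.joinxx.
Qed.
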